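(* There is a constant $\omega > 0$ such that for every finite set $V$ with $|V|\ge 10$, every $p\ge 0$ and every function $g$ from the set of squares over $V$ to $\mu_2$: if $g$ fails the cube condition with probability at most $p$, then there are a sign $\epsilon\in\mu_2$, a (not necessarily symmetric) function $f$ assigning to each ordered pair $(i,j)$ of distinct elements of $V$ a value $f_{ij}\in\mu_2$, and a function $g'$ from the squares over $V$ to $\mu_2$ such that $g'_{ijk\ell} = \epsilon f_{ij}f_{kj}f_{k\ell}f_{i\ell}$ for all distinct $i,j,k,\ell\in V$, and $\Pr\{g_c\ne g'_c\}\le \omega^{-1}p$, where $c$ is a uniformly random square over $V$.
   Context: $\mu_2=\{1,-1\}$ (multiplicative group). A square ($2$-cell) over $V$ is a $4$-element subset of $V$ endowed with the graph structure of a $4$-cycle; $(ijk\ell)$ denotes the square with edges $ij, jk, k\ell,\ell i$, and $g_{ijk\ell}$ is the value of $g$ on it, so that a function on squares is a function of ordered $4$-tuples of distinct elements invariant under the action of the dihedral group $D_4$ on the positions. A cube ($3$-cell) over $V$ is an $8$-element subset of $V$ endowed with the graph structure of the $3$-dimensional cube $\{0,1\}^3$; it has six square faces. The cube condition for $g$ at a cube is the requirement that the product of the values of $g$ over the six square faces of the cube equals $1$. ''$g$ fails the cube condition with probability at most $p$'' means that for a uniformly random cube over $V$, the probability that this product is $-1$ is at most $p$. *)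

(* Defs.v *)
From mathcomp Require Import all_boot all_order all_algebra reals.

Set Implicit Arguments.
Unset Strict Implicit.
Unset Printing Implicit Defensive.

Import Order.TTheory GRing.Theory Num.Theory.
Local Open Scope ring_scope.

Definition mu2 : {pred int} := [pred z | (z == 1) || (z == -1)].

Definition uniform_pr (R : realType) (T : finType) (A : pred T) : R :=
  #|A|%:R / #|T|%:R.

Section SquaresAndCubes.
Variable V : finType.

(* A 4-cycle, resp. 3-cube, on a subset of V has no isolated vertex, so it is
   represented by its edge set, edges being 2-element subsets of V. *)

Definition quad (i j k l : V) : {set {set V}} :=
  [set [set i; j]; [set j; k]; [set k; l]; [set l; i]].

Definition is_square (E : {set {set V}}) : bool :=
  [exists i, exists j, exists k, exists l,
    uniq [:: i; j; k; l] && (E == quad i j k l)].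

Definition square : finType := {E : {set {set V}} | is_square E}.

Lemma quad_is_square i j k l : uniq [:: i; j; k; l] -> is_square (quad i j k l).
Proof.
move=> u; apply/existsP; exists i; apply/existsP; exists j.
by apply/existsP; exists k; apply/existsP; exists l; rewrite u eqxx.
Qed.

Definition Square i j k l (u : uniq [:: i; j; k; l]) : square :=
  exist _ (quad i j k l) (quad_is_square u).

Definition Q3 : finType := {ffun 'I_3 -> bool}.

Definition Q3_adj (u v : Q3) : bool := #|[set d | u d != v d]| == 1%N.

Definition cube_edges (x : {ffun Q3 -> V}) : {set {set V}} :=
  [set [set x u; x v] | u in Q3, v in Q3 & Q3_adj u v].

Definition is_cube (E : {set {set V}}) : bool :=
  [exists x : {ffun Q3 -> V}, injectiveb x && (E == cube_edges x)].

Definition cube : finType := {E : {set {set V}} | is_cube E}.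

(* The image under [x] of the face {u | u d = b} of the standard cube. *)
Definition face_edges (x : {ffun Q3 -> V}) (d : 'I_3) (b : bool) :
    {set {set V}} :=
  [set [set x u; x v] | u in Q3, v in Q3
                      & [&& u d == b, v d == b & Q3_adj u v]].

(* Automorphisms of the standard cube permute its faces, so the choice of the
   labelling [x] of [C] does not matter. *)
Definition is_face (C : cube) (s : square) : bool :=
  [exists x : {ffun Q3 -> V}, exists d : 'I_3, exists b : bool,
    [&& injectiveb x, sval C == cube_edges x & sval s == face_edges x d b]].

Definition cube_prod (g : square -> int) (C : cube) : int :=
  \prod_(s : square | is_face C s) g s.

End SquaresAndCubes.

(* Main.v *)
Require Import Defs.
From mathcomp Require Import all_boot all_order all_algebra reals.
From mathcomp Require Import boolp ring.

(* Write signs additively, as booleans under exclusive or, and g as G(i j k l).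

   Exact case, on a vertex set S with at least 10 points: comparing two cubes that
   differ in one vertex shows that D = G(i j k l) + G(i' j k l) does not depend on
   k and is a coboundary in (j, l).  Hence e := G(i j k l) + G(i j m l) + G(k j m l)
   is a constant.  After fixing a base point o, e + G(i j o l) is a coboundary in
   (j, l), which yields f up to a function of the first index; that function is
   chosen so that f i j + f j i is a constant s, and this makes the formula for g'
   invariant under the dihedral group.  Normalised at three base points, the
   solution (e, s, f) is unique.

   Robust case: fix an injective 10-tuple z and define f i j from the unique
   solution on z and {i, j}.  If the formula fails at (i, j, k, l), then some
   failing cube lies inside the at most 14 points of z and {i, j, k, l}.  Since
   8 of the 14 positions carry a failing cube and the other 6 are free, averaging
   over z gives a z for which the failing squares are at most a constant times as
   frequent as the failing cubes.  The count allows coincidences between z and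
   (i, j, k, l), so small V needs no separate treatment. *)

Set Implicit Arguments.
Unset Strict Implicit.
Unset Printing Implicit Defensive.

Import Order.TTheory GRing.Theory Num.Theory.

(** * Lists of distinct points of a set *)

Section DistinctPoints.
Variable V : finType.
Implicit Types (S : {set V}) (s : seq V).

Definition distinct_in S s := uniq s && all (mem S) s.

Lemma distinct_in_setD1 S x s :
  distinct_in (S :\ x) s = (x \notin s) && distinct_in S s.
Proof.
rewrite /distinct_in andbCA; case: (uniq s) => //=.
elim: s => //= y s ->; rewrite !inE negb_or [y == x]eq_sym.
by case: (x != y); case: (x \notin s); case: (y \in S).
Qed.

Lemma extend_distinct S s :
  distinct_in S s -> size s < #|S| -> exists x, distinct_in S (x :: s).
Proof.
move=> /andP[us ss] lts; have : ~~ (S \subset s).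
  apply: contraL lts => sub; rewrite -leqNgt.
  exact: leq_trans (subset_leq_card sub) (card_size s).
by case/subsetPn=> x xS xs; exists x; rewrite /distinct_in /= xs us xS.
Qed.

End DistinctPoints.

(* Loops if a section hypothesis, which [move:] cannot clear, matches. *)
Ltac distinct :=
  repeat match goal with
  | H : is_true ?P |- _ =>
    lazymatch P with
    | context [distinct_in _ _] => move: H
    | uniq _ => move: H
    | ~~ (_ \in _) => move: H
    end
  end;
  rewrite /distinct_in /= ?in_cons ?in_nil ?negb_or ?orbF ?andbT;
  intros;
  repeat match goal with
  | H : is_true (_ && _) |- _ => case/andP: H; intros
  end;
  repeat (apply/andP; split);
  solve [ done | assumption | rewrite eq_sym; assumption ].

(** * Functions of pairs and triples that survive the exchange of one point *)

Section Constancy.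
Variables (V : finType) (T : Type).
Implicit Type S : {set V}.

(** The entries are replaced one at a time, with transpositions in between; [j = a] is treated apart
    because the intermediate pair [(j, a)] would be degenerate. *)
Lemma pair_const S (P : V -> V -> T) :
  (forall i j, distinct_in S [:: i; j] -> P i j = P j i) ->
  (forall i j l, distinct_in S [:: i; j; l] -> P i j = P i l) ->
  forall i j a b, distinct_in S [:: i; j] -> distinct_in S [:: a; b] ->
  P i j = P a b.
Proof.
move=> sym swap i j a b ij ab.
have row x y z : distinct_in S [:: x; y] -> distinct_in S [:: x; z] -> P x y = P x z.
  by have [->//|nyz xy xz] := eqVneq y z; apply: swap; distinct.
have [ia|nia] := eqVneq i a; first by move: ij; rewrite ia => ij; apply: row.
have [ja|nja] := eqVneq j a.
  by rewrite sym // ja; apply: row => //; rewrite -ja; distinct.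
rewrite sym // (row j i a); try distinct.
by rewrite sym; [apply: row|]; distinct.
Qed.

(** One exchange brings [a] into the triple; the other two points then vary by [pair_const] on
    [S :\ a]. *)
Lemma triple_const S (P : V -> V -> V -> T) :
  (forall i j k, P i j k = P j i k) -> (forall i j k, P i j k = P i k j) ->
  (forall i j k l, distinct_in S [:: i; j; k; l] -> P i j k = P i j l) ->
  forall i j k a b c, distinct_in S [:: i; j; k] -> distinct_in S [:: a; b; c] ->
  P i j k = P a b c.
Proof.
move=> sym1 sym2 swap i j k a b c ijk abc.
have tail y z : distinct_in S [:: a; y; z] -> P a y z = P a b c.
  move=> ayz; apply: (@pair_const (S :\ a) (P a)) => // [m n p||].
  - by rewrite distinct_in_setD1 => amnp; apply: swap; distinct.
  - by rewrite distinct_in_setD1; distinct.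
  - by rewrite distinct_in_setD1; distinct.
have [ia|nia] := eqVneq i a; first by rewrite ia tail // -ia.
have [ja|nja] := eqVneq j a; first by rewrite sym1 ja tail // -ja; distinct.
have [ka|nka] := eqVneq k a; first by rewrite sym2 sym1 ka tail // -ka; distinct.
rewrite sym1 sym2 (@swap j k i a); last by distinct.
by rewrite sym2 sym1 tail //; distinct.
Qed.

End Constancy.

(** * Edge functions whose sum around every 4-cycle vanishes *)

Section EdgeCocycle.
Variables (V : finType) (S : {set V}) (h : V -> V -> bool).
Hypothesis hC : forall i j, h i j = h j i.
Hypothesis h4 : forall i j k l, distinct_in S [:: i; j; k; l] ->
  h i j (+) h j k (+) h k l (+) h l i = false.

Lemma edge_cocycle : 2 < #|S| ->
  exists s u, forall i j, distinct_in S [:: i; j] -> h i j = s (+) u i (+) u j.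
Proof.
move=> cardS; pose t i j k := h i j (+) h j k (+) h i k.
have tE : forall i j k a b c, distinct_in S [:: i; j; k] ->
    distinct_in S [:: a; b; c] -> t i j k = t a b c.
  apply: triple_const => [i j k|i j k|i j k l ijkl]; rewrite /t.
  - by rewrite (hC j i); case: (h i j); case: (h j k); case: (h i k).
  - by rewrite (hC k j); case: (h i j); case: (h j k); case: (h i k).
  (* The 4-cycle [i k j l] is the sum of the triangles [i j k] and [i j l]. *)
  have := @h4 i k j l; rewrite (hC k j) (hC l i) => /(_ ltac:(distinct)).
  by case: (h i j); case: (h j k); case: (h i k); case: (h j l); case: (h i l).
have [a Sa] : exists a, distinct_in S [:: a].
  by apply: extend_distinct => //; apply: leq_trans cardS.
have [b Sab] : exists b, distinct_in S [:: b; a].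
  by apply: extend_distinct => //; apply: leq_trans cardS.
have [c Sabc] := extend_distinct Sab cardS.
(* With [u j = h j a], the edge [a j] forces [u a] to cancel the constant. *)
exists (t c b a), (fun i => if i == a then t c b a else h i a) => i j Sij.
have [ia|nia] := eqVneq i a; have [ja|nja] := eqVneq j a.
- by move: Sij; rewrite /distinct_in ia ja /= inE eqxx.
- by rewrite ia addbb hC.
- by rewrite ja addbAC addbb.
rewrite -(tE i j a c b a) // /t; last by distinct.
by case: (h i j); case: (h i a); case: (h j a).
Qed.

End EdgeCocycle.

(** * Consequences of the cube relation on a closed set *)

Section Rigidity.
Variables (V : finType) (G : V -> V -> V -> V -> bool).
Hypothesis Grot : forall i j k l, G i j k l = G j k l i.
Hypothesis Gref : forall i j k l, G i j k l = G i l k j.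

(** [i j k l] and [a b c d] are opposite faces, joined by the edges [i a], [j b], [k c], [l d]. *)
Definition cube_sum i j k l a b c d :=
  G i j k l (+) G a b c d (+) G i j b a (+) G j k c b (+) G k l d c (+) G l i a d.

Definition closed_on (S : {set V}) :=
  forall i j k l a b c d, distinct_in S [:: i; j; k; l; a; b; c; d] ->
    cube_sum i j k l a b c d = false.

(** Adding to [F i j] a function of [i] or a function of [j] does not affect the last clause; the
    first three clauses remove this freedom. *)
Definition solves (S : {set V}) o p q e s (F : V -> V -> bool) :=
  [/\ forall j, distinct_in S [:: o; j] -> F o j = false,
      F p q = false,
      forall i j, distinct_in S [:: i; j] -> F i j (+) F j i = s
    & forall i j k l, distinct_in S [:: i; j; k; l] ->
        G i j k l = e (+) F i j (+) F k j (+) F k l (+) F i l].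

Lemma Gsym13 i j k l : G i j k l = G k j i l.
Proof. by rewrite Grot Grot Gref. Qed.

Section Closed.
Variable S : {set V}.
Hypothesis Sclosed : closed_on S.

(* The difference of two cubes which differ in one vertex. *)
Lemma vertex_swap i i' j l a k b d c :
  distinct_in S [:: i; i'; j; l; a; k; b; d; c] ->
  G i j k l (+) G i' j k l (+) G i j b a (+) G i' j b a
    (+) G i l d a (+) G i' l d a = false.
Proof.
move=> H; have := @Sclosed i j k l a b c d ltac:(distinct).
have := @Sclosed i' j k l a b c d ltac:(distinct).
rewrite /cube_sum (Grot l i) (Grot l i') (Gref i a) (Gref i' a).
case: (G a b c d); case: (G j k c b); case: (G k l d c);
by case: (G i j k l); case: (G i' j k l); case: (G i j b a); case: (G i' j b a);
   case: (G i l d a); case: (G i' l d a).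
Qed.

Hypothesis cardS : 10 <= #|S|.

(** Two instances of [vertex_swap] that differ only in [k] are added. The six given points and four
    auxiliary ones account for the bound 10. *)
Lemma swap13 i i' j l k k' : distinct_in S [:: i; i'; j; l; k; k'] ->
  G i j k l (+) G i' j k l (+) G i j k' l (+) G i' j k' l = false.
Proof.
move=> H.
have [a Ha] := extend_distinct H (leq_trans (isT : 6 < 10) cardS).
have [b Hb] := extend_distinct Ha (leq_trans (isT : 7 < 10) cardS).
have [c Hc] := extend_distinct Hb (leq_trans (isT : 8 < 10) cardS).
have [d Hd] := extend_distinct Hc cardS.
have := @vertex_swap i i' j l a k b d c ltac:(clear H Ha Hb Hc; distinct).
have := @vertex_swap i i' j l a k' b d c ltac:(clear H Ha Hb Hc; distinct).
case: (G i j b a); case: (G i' j b a); case: (G i l d a); case: (G i' l d a);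
by case: (G i j k l); case: (G i' j k l); case: (G i j k' l); case: (G i' j k' l).
Qed.

(** By [swap13], the vertices [b] and [d] opposite to [i] in [vertex_swap] can both be replaced by
    [k]. *)
Lemma swap1_cocycle i i' j l a k : distinct_in S [:: i; i'; j; l; a; k] ->
  G i j k l (+) G i' j k l (+) G i j k a (+) G i' j k a
    (+) G i l k a (+) G i' l k a = false.
Proof.
move=> H.
have [b Hb] := extend_distinct H (leq_trans (isT : 6 < 10) cardS).
have [c Hc] := extend_distinct Hb (leq_trans (isT : 7 < 10) cardS).
have [d Hd] := extend_distinct Hc (leq_trans (isT : 8 < 10) cardS).
have := @vertex_swap i i' j l a k b d c ltac:(clear H Hb Hc; distinct).
have := @swap13 i i' j a b k ltac:(clear H Hb Hc; distinct).
have := @swap13 i i' l a d k ltac:(clear H Hb Hc; distinct).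
case: (G i j k l); case: (G i' j k l);
case: (G i j b a); case: (G i' j b a); case: (G i j k a); case: (G i' j k a);
by case: (G i l d a); case: (G i' l d a); case: (G i l k a); case: (G i' l k a).
Qed.

(** In the sought formula each of [i], [k], [m] contributes its two [f]-terms twice, so that this
    sum is three times [e], which is [e]. *)
Definition triad j l i k m := G i j k l (+) G i j m l (+) G k j m l.

(** For fixed ends [j], [l], [swap13] allows the exchange of one of [i], [k], [m]; for fixed [i],
    [k], [m], [swap1_cocycle] allows the exchange of an end. *)
Lemma triad_const j l i k m j' l' i' k' m' :
  distinct_in S [:: j; l; i; k; m] -> distinct_in S [:: j'; l'; i'; k'; m'] ->
  triad j l i k m = triad j' l' i' k' m'.
Proof.
have mid x y z u v x' y' z' : distinct_in S [:: u; v; x; y; z] ->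
    distinct_in S [:: u; v; x'; y'; z'] -> triad u v x y z = triad u v x' y' z'.
  move=> H H'; apply: (@triple_const _ _ (S :\ u :\ v) (triad u v)).
  - move=> a b c; rewrite /triad (Gsym13 b u a).
    by case: (G a u b v); case: (G a u c v); case: (G b u c v).
  - move=> a b c; rewrite /triad (Gsym13 c u b).
    by case: (G a u b v); case: (G a u c v); case: (G b u c v).
  - move=> a b c d; rewrite !distinct_in_setD1 => abcd; rewrite /triad.
    have := @swap13 a b u v c d ltac:(distinct).
    by case: (G a u b v); case: (G a u c v); case: (G b u c v);
      case: (G a u d v); case: (G b u d v).
  - by rewrite !distinct_in_setD1; distinct.
  - by rewrite !distinct_in_setD1; distinct.
have ends x y z u v u' v' : distinct_in S [:: u; v; x; y; z] ->
    distinct_in S [:: u'; v'; x; y; z] -> triad u v x y z = triad u' v' x y z.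
  move=> H H'.
  apply: (@pair_const _ _ (S :\ x :\ y :\ z) (fun u v => triad u v x y z)).
  - by move=> a b; rewrite /triad !(Gref _ b).
  - move=> a b c; rewrite !distinct_in_setD1 => abc; rewrite /triad.
    have := @swap1_cocycle b c x y z a ltac:(distinct).
    rewrite !(Grot b) !(Grot c).
    by case: (G x a y b); case: (G x a z b); case: (G y a z b);
      case: (G x a y c); case: (G x a z c); case: (G y a z c).
  - by rewrite !distinct_in_setD1; distinct.
  - by rewrite !distinct_in_setD1; distinct.
(* A triple [x], [y], [z] away from both pairs of ends links the two triads. *)
move=> H H'; pose S' := S :\ j :\ l :\ j' :\ l'.
have cardS' : 2 < #|S'|.
  have drop1 r (X : {set V}) t : r.+1 < #|X| -> r < #|X :\ t|.
    by rewrite (cardsD1 t X); case: (t \in X) => // /ltnW.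
  apply: leq_trans (drop1 5 _ _ (drop1 6 _ _ (drop1 7 _ _ (drop1 8 _ _ cardS)))).
  by [].
have [x Hx] : exists x, distinct_in S' [:: x].
  by apply: extend_distinct => //; apply: leq_trans cardS'.
have [y Hy] : exists y, distinct_in S' [:: y; x].
  by apply: extend_distinct => //; apply: leq_trans cardS'.
have [z] := extend_distinct Hy cardS'; rewrite !distinct_in_setD1 => Hz.
rewrite (@mid _ _ _ _ _ x y z) //; last by distinct.
rewrite (@ends _ _ _ _ _ j' l'); try distinct.
by apply: mid => //; distinct.
Qed.

Lemma triad_constE : exists e, forall j l i k m,
  distinct_in S [:: j; l; i; k; m] -> triad j l i k m = e.
Proof.
have [[[[[j l] i] k] m] H] : exists t : V * V * V * V * V,
    let: (j, l, i, k, m) := t in distinct_in S [:: j; l; i; k; m].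
  have H0 : distinct_in S [::] by [].
  have [a Ha] := extend_distinct H0 (leq_trans (isT : 0 < 10) cardS).
  have [b Hb] := extend_distinct Ha (leq_trans (isT : 1 < 10) cardS).
  have [c Hc] := extend_distinct Hb (leq_trans (isT : 2 < 10) cardS).
  have [d Hd] := extend_distinct Hc (leq_trans (isT : 3 < 10) cardS).
  have [e He] := extend_distinct Hd (leq_trans (isT : 4 < 10) cardS).
  by exists (e, d, c, b, a).
by exists (triad j l i k m) => j' l' i' k' m' H'; apply: triad_const.
Qed.

End Closed.

End Rigidity.

(** * Existence and uniqueness of the normalised solution *)

Section Solution.
Variables (V : finType) (G : V -> V -> V -> V -> bool).
Hypothesis Grot : forall i j k l, G i j k l = G j k l i.
Hypothesis Gref : forall i j k l, G i j k l = G i l k j.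
Variables (S : {set V}) (o p q : V).

(** Since row [o] vanishes, the formula at [i j o l] reads [F i j (+) F i l = e (+) G i j o l]. This
    is integrated along each row from a reference point, and the rows are then shifted to make
    [F i j (+) F j i] constant. *)
Lemma solution_exists : distinct_in S [:: o; p; q] -> closed_on G S -> 10 <= #|S| ->
  exists e s F, solves G S o p q e s F.
Proof.
move=> opq Sclosed cardS; have [e eE] := triad_constE Grot Gref Sclosed cardS.
(* [b i] is the point where row [i] of [phi] is set to [false]. *)
have [b bP] : exists b, forall i, distinct_in S [:: i; o] -> distinct_in S [:: b i; i; o].
  exists (fun i => if i == p then q else p) => i.
  by have [->|nip] := eqVneq i p; distinct.
have [phi phi_def] : exists phi, forall i j,
    phi i j = (j != b i) && (e (+) G i j o (b i)) by eexists.
(* On points other than [o], phi is determined up to a function of [i]. *)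
have phiE i j l : distinct_in S [:: i; j; l; o] ->
    phi i j (+) phi i l = e (+) G i j o l.
  move=> H; rewrite !phi_def.
  have /bP Hb : distinct_in S [:: i; o] by distinct.
  have [jb|njb] := eqVneq j (b i); have [lb|nlb] := eqVneq l (b i).
  - by move: H; rewrite /distinct_in /= jb lb !inE eqxx /= ?andbF.
  - by rewrite jb /= Gref.
  - by rewrite lb /= addbF.
  have := eE i o j l (b i) ltac:(distinct).
  rewrite /triad !(Grot _ i) (Gref i l) !(Gref i (b i)) /= => <-.
  by case: (G i j o l); case: (G i j o (b i)); case: (G i l o (b i)).
have E4 i j k l : distinct_in S [:: i; j; k; l; o] ->
    G i j k l = e (+) G i j o l (+) G k j o l.
  move=> H; have := eE j l i k o ltac:(distinct); rewrite /triad => <-.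
  by case: (G i j k l); case: (G i j o l); case: (G k j o l).
(* The sum of [phi i j (+) phi j i] around a 4-cycle, regrouped by first index, is
   [G i j k l (+) G j i l k]: two readings of one square, which cancel. *)
have [s [u hE]] : exists s u, forall i j, distinct_in (S :\ o) [:: i; j] ->
    phi i j (+) phi j i = s (+) u i (+) u j.
  apply: (edge_cocycle (S := S :\ o)) => [i j|i j k l|]; first by rewrite addbC.
    rewrite distinct_in_setD1 => H.
    have Hi := phiE i j l ltac:(distinct); have Hj := phiE j i k ltac:(distinct).
    have Hk := phiE k j l ltac:(distinct); have Hl := phiE l i k ltac:(distinct).
    have Hjl := E4 i j k l ltac:(distinct); have Hik := E4 j i l k ltac:(distinct).
    have Gijkl : G j i l k = G i j k l by rewrite Gref -Grot Gsym13.
    have -> : phi i j (+) phi j i (+) (phi j k (+) phi k j)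
          (+) (phi k l (+) phi l k) (+) (phi l i (+) phi i l)
        = (phi i j (+) phi i l) (+) (phi j i (+) phi j k)
          (+) (phi k j (+) phi k l) (+) (phi l i (+) phi l k).
      move: (phi i j) (phi j i) (phi j k) (phi k j) (phi k l) (phi l k) (phi l i).
      by do 7!case; case: (phi i l).
    rewrite Hi Hj Hk Hl; move: Gijkl; rewrite Hjl Hik.
    by case: (G j i o k); case: (G l i o k); case: (G i j o l); case: (G k j o l); case: (e).
  move: cardS; rewrite (cardsD1 o S); case: (o \in S) => {}cardS.
    exact: leq_trans (cardS : 9 <= #|S :\ o|).
  exact: leq_trans cardS.
have [c cE] : exists c, phi p q (+) u p (+) c = false.
  by exists (phi p q (+) u p); rewrite addbb.
(* The shift by [u i] leaves differences within a row unchanged and cancels [u i (+) u j] in [hE];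
   [c] normalises [F p q]. The column of [o] is [s] because its row is [false]. *)
have [F F_def] : exists F, forall i j, F i j =
    if i == o then false else if j == o then s else phi i j (+) u i (+) c by eexists.
exists e, s, F.
have Fo j : F o j = false by rewrite F_def eqxx.
have Fro i : i != o -> F i o = s by move/negPf=> io; rewrite F_def io eqxx.
have FE i j : i != o -> j != o -> F i j = phi i j (+) u i (+) c.
  by move=> /negPf io /negPf jo; rewrite F_def io jo.
have Fsym i j : distinct_in S [:: i; j] -> F i j (+) F j i = s.
  move=> H; have [io|nio] := eqVneq i o; have [jo|njo] := eqVneq j o.
  - by move: H; rewrite /distinct_in io jo /= inE eqxx.
  - by rewrite io Fo Fro.
  - by rewrite jo Fo Fro ?addbF.
  rewrite !FE //; have := hE i j; rewrite distinct_in_setD1 => /(_ ltac:(distinct)).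
  by case: (phi i j); case: (phi j i); case: (u i); case: (u j); case: (s); case: (c).
have Frow i j l : distinct_in S [:: i; j; l; o] ->
    F i j (+) F i l = e (+) G i j o l.
  move=> H; rewrite -phiE // !FE; try distinct.
  by case: (phi i j); case: (phi i l); case: (u i); case: (c).
have Fcol i k l : distinct_in S [:: i; l; k; o] ->
   F i l (+) F k l = e (+) G i o k l.
  move=> H; have := Frow l i k ltac:(distinct).
  have := Fsym i l ltac:(distinct); have := Fsym k l ltac:(distinct).
  have -> : G i o k l = G l i o k by rewrite (Grot l).
  move=> <- + <-.
  by case: (F i l); case: (F k l); case: (F l i); case: (F l k).
split=> //.
- by rewrite FE ?cE //; distinct.
move=> i j k l H.
have [io|nio] := eqVneq i o.
  subst i; rewrite !Fo !addbF Gsym13 //.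
  by have := Frow k j l ltac:(distinct) => E; rewrite -addbA E addKb.
have [ko|nko] := eqVneq k o.
  subst k; rewrite !Fo !addbF.
  by have := Frow i j l ltac:(distinct) => E; rewrite -addbA E addKb.
have [jo|njo] := eqVneq j o.
  subst j; rewrite !Fro //; have := Fcol i k l ltac:(distinct).
  by case: (F i l); case: (F k l); case: (e); case: (s); case: (G i o k l).
have [lo|nlo] := eqVneq l o.
  subst l; rewrite !Fro // Gref; have := Fcol i k j ltac:(distinct).
  by case: (F i j); case: (F k j); case: (e); case: (s); case: (G i o k j).
have := Frow i j l ltac:(distinct); have := Frow k j l ltac:(distinct).
have := E4 i j k l ltac:(distinct) => ->.
case: (F i j); case: (F i l); case: (F k j); case: (F k l);
by case: (G i j o l); case: (G k j o l); case: (e).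
Qed.

(** The difference [d] of two solutions satisfies the formula with constant [e (+) e']. Three
    squares with opposite corners [m], [n] give [e = e']. Then [d] is constant along rows off [o],
    the triangle [p q m] gives [s = s'], and so [d] is symmetric, hence constant off [o] and equal
    to [d p q]. *)
Lemma solution_unique e s F e' s' F' : distinct_in S [:: o; p; q] -> 4 < #|S| ->
  solves G S o p q e s F -> solves G S o p q e' s' F' ->
  [/\ e = e', s = s' & forall i j, distinct_in S [:: i; j] -> F i j = F' i j].
Proof.
move=> opq cardS [Fo Fpq Fs FG] [Fo' Fpq' Fs' FG'].
have [m Hm] := extend_distinct opq (leq_trans (isT : 3 < 5) cardS).
have [n Hn] := extend_distinct Hm cardS.
have [d dE] : exists d, forall i j, d i j = F i j (+) F' i j by eexists.
have dG i j k l : distinct_in S [:: i; j; k; l] ->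
    d i j (+) d k j (+) d k l (+) d i l = e (+) e'.
  move=> H; have := FG _ _ _ _ H; rewrite (FG' _ _ _ _ H) !dE.
  case: (F i j); case: (F i l); case: (F k j); case: (F k l); case: (e); case: (e');
  by case: (F' i j); case: (F' i l); case: (F' k j); case: (F' k l).
have ds i j : distinct_in S [:: i; j] -> d i j (+) d j i = s (+) s'.
  move=> H; rewrite -(Fs i j) // -(Fs' i j) // !dE.
  by case: (F i j); case: (F' i j); case: (F j i); case: (F' j i).
have do_ j : distinct_in S [:: o; j] -> d o j = false.
  by move=> H; rewrite dE Fo ?Fo'.
have ee' : e = e'.
  have := dG o m p n ltac:(distinct); have := dG o m q n ltac:(distinct).
  have := dG p m q n ltac:(distinct).
  case: (d o m); case: (d o n); case: (d p m); case: (d p n);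
  by case: (d q m); case: (d q n); case: (e); case: (e').
rewrite {}ee' addbb in dG *.
have drow i j l : distinct_in S [:: i; j; l; o] -> d i j = d i l.
  move=> H; have := dG i j o l ltac:(distinct).
  by rewrite !do_; try distinct; case: (d i j); case: (d i l).
have ss' : s = s'.
  have := ds p q ltac:(distinct); have := ds q m ltac:(distinct).
  have := ds m p ltac:(distinct).
  rewrite (drow p q m) ?(drow q p m) ?(drow m p q); try distinct.
  by case: (d p m); case: (d q m); case: (d m q); case: (s); case: (s').
rewrite {}ss' addbb in ds *; split=> // i j H.
suff: d i j = false by rewrite dE; case: (F i j); case: (F' i j).
have dC x y : distinct_in S [:: x; y] -> d x y = d y x.
  by move=> /ds; case: (d x y); case: (d y x).
have [io|nio] := eqVneq i o; first by rewrite io do_ // -io.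
have [jo|njo] := eqVneq j o; first by rewrite dC // jo do_ //; distinct.
have dpq : d p q = false by rewrite dE Fpq Fpq'.
rewrite -dpq.
have H' : distinct_in (S :\ o) [:: i; j] by rewrite distinct_in_setD1; distinct.
apply: (pair_const (S := S :\ o)) => // [x y|x y z|]; rewrite distinct_in_setD1.
- by move=> ?; apply: dC; distinct.
- by move=> ?; apply: drow; distinct.
by distinct.
Qed.

Lemma solves_subset (S' : {set V}) e s F :
  S' \subset S -> solves G S o p q e s F -> solves G S' o p q e s F.
Proof.
move=> /subsetP sub [Fo Fpq Fs FG].
have mono t : distinct_in S' t -> distinct_in S t.
  by rewrite /distinct_in => /andP[-> /allP all']; apply/allP=> x /all' /sub.
split=> // [j /mono|i j /mono|i j k l /mono]; [exact: Fo|exact: Fs|exact: FG].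
Qed.

End Solution.

(** * Decoding [f] from local solutions *)

Section Decoding.
Variables (V : finType) (G : V -> V -> V -> V -> bool).
Hypothesis Grot : forall i j k l, G i j k l = G j k l i.
Hypothesis Gref : forall i j k l, G i j k l = G i l k j.

(* The value of [f i j] is read off the unique normalised solution on
   [Z :|: [set i; j]], so that it depends on [G] only locally. *)
Lemma local_decoding (Z : {set V}) : 10 <= #|Z| ->
  exists e s f, (forall i j, i != j -> f i j (+) f j i = s) /\
    forall i j k l, uniq [:: i; j; k; l] -> closed_on G (Z :|: [set i; j; k; l]) ->
      G i j k l = e (+) f i j (+) f k j (+) f k l (+) f i l.
Proof.
move=> cardZ.
have [q Hq] : exists q, distinct_in Z [:: q].
  by apply: extend_distinct => //; apply: leq_trans cardZ.
have [p Hp] := extend_distinct Hq (leq_trans (isT : 1 < 10) cardZ).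
have [o opq] := extend_distinct Hp (leq_trans (isT : 2 < 10) cardZ).
(* By uniqueness these propositions have the truth values of the constants of any solution on [Z];
   without a solution they are [false]. *)
pose e := `[< exists s F, solves G Z o p q true s F >].
pose s := `[< exists e F, solves G Z o p q e true F >].
pose loc i j := `[< exists e s F,
  solves G (Z :|: [set i; j]) o p q e s F /\ F i j >].
have in_super (S : {set V}) t : Z \subset S -> distinct_in Z t -> distinct_in S t.
  move=> /subsetP sub /andP[ut /allP tZ]; rewrite /distinct_in ut.
  by apply/allP=> x /tZ /sub.
have super_card (S : {set V}) : Z \subset S -> 10 <= #|S|.
  by move/subset_leq_card; apply: leq_trans.
have locP (S : {set V}) : Z \subset S -> closed_on G S -> exists F,
    solves G S o p q e s F /\ forall i j, distinct_in S [:: i; j] -> loc i j = F i j.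
  move=> ZS Sclosed.
  have [e' [s' [F FS]]] :=
    solution_exists Grot Gref (in_super _ _ ZS opq) Sclosed (super_card _ ZS).
  have FZ := solves_subset ZS FS.
  have uZ e1 s1 F1 := solution_unique (e' := e1) (s' := s1) (F' := F1) opq
    (leq_trans (isT : 4 < 10) cardZ) FZ.
  have -> : e = e'.
    apply/asboolP/idP => [[s1 [F1 /uZ[-> //]]]|e'T].
    by exists s', F; rewrite -[true]e'T.
  have -> : s = s'.
    apply/asboolP/idP => [[e1 [F1 /uZ[_ -> //]]]|s'T].
    by exists e', F; rewrite -[true]s'T.
  exists F; split=> // i j ij.
  have Fij : solves G (Z :|: [set i; j]) o p q e' s' F.
    apply: solves_subset FS; rewrite subUset ZS; apply/subsetP=> x.
    by rewrite !inE; case/orP=> /eqP->; distinct.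
  apply/asboolP/idP => [[e1 [s1 [F1 [HF1]]]]|Fij1]; last by exists e', s', F.
  have Zij : Z \subset Z :|: [set i; j] by exact: subsetUl.
  have [_ _ ->//] := solution_unique (in_super _ _ Zij opq)
    (leq_trans (isT : 4 < 10) (super_card _ Zij)) Fij HF1.
  by move: ij; rewrite /distinct_in /= !inE !eqxx !orbT => /andP[->].
(* Reading only one order of each pair from [loc] makes [f i j (+) f j i = s] hold even where no
   local solution exists. *)
pose f i j := if enum_rank i < enum_rank j then loc i j else s (+) loc j i.
exists e, s, f; split=> [i j nij|i j k l ijkl Sclosed].
  rewrite /f; case: ltngtP => [_|_|/val_inj/enum_rank_inj eij].
  - by rewrite addbCA addbb addbF.
  - by rewrite -addbA addbb addbF.
  - by rewrite eij eqxx in nij.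
have [F [FS Floc]] := locP _ (subsetUl _ _) Sclosed.
have {ijkl} H : distinct_in (Z :|: [set i; j; k; l]) [:: i; j; k; l].
  by rewrite /distinct_in ijkl /= !inE !eqxx !orbT.
have fF x y : distinct_in (Z :|: [set i; j; k; l]) [:: x; y] -> f x y = F x y.
  move=> xy; rewrite /f !Floc //; last by distinct.
  by case: ltnP => // _; case: FS => _ _ Fs _; rewrite -(Fs x y) // -addbA addbb addbF.
by case: FS => _ _ _ ->//; rewrite !fF //; distinct.
Qed.

End Decoding.

(** * Counting by positions and by averaging *)

Section Counting.
Variable V : finType.

Lemma card_agree (T U : finType) (theta : U -> T) (x : U -> V) :
  injective theta ->
  #|[set y : {ffun T -> V} | [forall u, y (theta u) == x u]]|
    <= #|V| ^ (#|T| - #|U|).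
Proof.
move=> theta_inj; pose rest : finType := {t : T | t \notin codom theta}.
have -> : #|T| - #|U| = #|rest|.
  by rewrite card_sig -(card_codom theta_inj) -(cardC (mem (codom theta))) addKn.
rewrite -card_ffun; pose r (y : {ffun T -> V}) := [ffun t : rest => y (val t)].
apply: (@leq_card_in _ _ r) => y y'; rewrite !inE.
move=> /forallP yx /forallP y'x /ffunP rE; apply/ffunP=> t.
have [/codomP[u ->]|nt] := boolP (t \in codom theta).
  by rewrite (eqP (yx u)) (eqP (y'x u)).
by have := rE (Sub t nt); rewrite !ffunE.
Qed.

Lemma card_bigcup_leq (I T : finType) (P : pred I) (F : I -> {set T}) :
  #|\bigcup_(i | P i) F i| <= \sum_(i | P i) #|F i|.
Proof.
elim/big_rec2: _ => [|i m A _ leAm]; first by rewrite cards0.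
by apply: leq_trans (leq_card_setU _ _) _; rewrite leq_add2l.
Qed.

(** Union bound over the maps [theta] that tell at which position of [y] each [x u] occurs. As [x]
    is injective, only injective [theta] contribute, and [card_agree] applies to them. *)
Lemma card_covering (T U : finType) (B : {set {ffun U -> V}}) :
  {in B, forall x : {ffun U -> V}, injective x} ->
  #|[set y : {ffun T -> V} | [exists x in B, [forall u, x u \in codom y]]]|
    <= #|T| ^ #|U| * (#|B| * #|V| ^ (#|T| - #|U|)).
Proof.
move=> Binj; pose A (theta : {ffun U -> T}) (x : {ffun U -> V}) :=
  [set y : {ffun T -> V} | [forall u, y (theta u) == x u]].
have cardA theta x : x \in B -> #|A theta x| <= #|V| ^ (#|T| - #|U|).
  move=> xB; have [/injectiveP ti|nti] := boolP (injectiveb theta).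
    exact: card_agree.
  suff -> : A theta x = set0 by rewrite cards0.
  apply/setP=> y; rewrite !inE; apply: contraNF nti => /forallP yx.
  apply/injectiveP=> u v tuv; apply: (Binj x xB).
  by rewrite -(eqP (yx u)) -(eqP (yx v)) tuv.
apply: (@leq_trans #|\bigcup_(theta : {ffun U -> T}) \bigcup_(x in B) A theta x|).
  apply/subset_leq_card/subsetP=> y; rewrite inE => /existsP[x /andP[xB /forallP xy]].
  apply/bigcupP; exists [ffun u => iinv (xy u)] => //.
  apply/bigcupP; exists x => //; rewrite inE; apply/forallP=> u.
  by rewrite ffunE f_iinv.
apply: leq_trans (card_bigcup_leq _ _) _.
rewrite -card_ffun.
have -> n : #|{ffun U -> T}| * n = \sum_(theta : {ffun U -> T}) n by rewrite sum_nat_const.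
apply: leq_sum => theta _; rewrite -sum_nat_const.
apply: leq_trans (card_bigcup_leq _ _) _.
by apply: leq_sum => x; apply: cardA.
Qed.

Definition ffun_inl (A B : finType) (y : {ffun A + B -> V}) := [ffun a => y (inl a)].
Definition ffun_inr (A B : finType) (y : {ffun A + B -> V}) := [ffun b => y (inr b)].

(** Averaging: the right-hand side sums [#|W z|] over [Z], so a [z] with the fewest [W z] will
    do. *)
Lemma pigeonhole_fibre (A B : finType) (Z : {set {ffun A -> V}})
    (W : {ffun A -> V} -> {set {ffun B -> V}}) : Z != set0 ->
  exists2 z, z \in Z &
    #|Z| * #|W z| <=
      #|[set y : {ffun A + B -> V} | (ffun_inl y \in Z) && (ffun_inr y \in W (ffun_inl y))]|.
Proof.
case/set0Pn=> z0 z0Z; have [z zZ zmin] := @arg_minnP _ z0 (mem Z) (fun z => #|W z|) z0Z.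
exists z => //; rewrite -sum_nat_const.
apply: (@leq_trans (\sum_(z in Z) #|W z|)); first exact: leq_sum.
set Y := [set y | _]; rewrite -sum1_card.
rewrite (partition_big (@ffun_inl A B) (mem Z)) /=; last first.
  by move=> y; rewrite inE => /andP[].
apply: leq_sum => z1 z1Z; rewrite sum1_card.
pose join (w : {ffun B -> V}) : {ffun A + B -> V} :=
  [ffun t => match t with inl a => z1 a | inr b => w b end].
have joinl w : ffun_inl (join w) = z1 by apply/ffunP=> a; rewrite !ffunE.
have joinr w : ffun_inr (join w) = w by apply/ffunP=> a; rewrite !ffunE.
rewrite -(card_imset _ (can_inj joinr)); apply/subset_leq_card/subsetP=> _ /imsetP[w wW ->].
by rewrite unfold_in /= inE joinl joinr eqxx z1Z wW.
Qed.

End Counting.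

(** * Labellings of a 4-cycle *)

Section Quads.
Variable V : finType.
Implicit Types i j k l : V.

Lemma quad_rot i j k l : quad i j k l = quad j k l i.
Proof.
apply/setP=> E; rewrite !inE.
by case: (E == [set i; j]); rewrite /= ?orbT ?orbF.
Qed.

Lemma quad_ref i j k l : quad i j k l = quad i l k j.
Proof.
apply/setP=> E; rewrite !inE (setUC [set l] [set i]) (setUC [set k] [set l]).
rewrite (setUC [set j] [set k]) (setUC [set i] [set j]).
case: (E == [set j; i]); case: (E == [set k; j]);
by case: (E == [set l; k]); case: (E == [set i; l]).
Qed.

Lemma cover_quad i j k l : cover (quad i j k l) =i [:: i; j; k; l].
Proof.
move=> v; apply/bigcupP/idP => [[E]|].
  by rewrite !inE -!orbA => /or4P[] /eqP->; rewrite !inE => /orP[] ->; rewrite ?orbT.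
by rewrite !inE => /or4P[] /eqP->; [exists [set i; j]|exists [set i; j]
  |exists [set k; l]|exists [set k; l]]; rewrite ?inE ?eqxx ?orbT.
Qed.

Lemma eq_set2 (a b c d : V) : [set a; b] = [set c; d] -> (a = c /\ b = d) \/ (a = d /\ b = c).
Proof.
move=> E.
have : a \in [set c; d] by rewrite -E set21.
have : b \in [set c; d] by rewrite -E set22.
have : c \in [set a; b] by rewrite E set21.
have : d \in [set a; b] by rewrite E set22.
rewrite !inE => /orP[]/eqP da /orP[]/eqP ca /orP[]/eqP bc /orP[]/eqP ac.
all: by subst; auto.
Qed.

Lemma quad_neighbour i j k l v :
  uniq [:: i; j; k; l] -> [set j; v] \in quad i j k l -> v = i \/ v = k.
Proof.
rewrite /= !inE !negb_or => /and4P[/and3P[nij _ _] /andP[njk njl] _ _].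
rewrite -!orbA => /or4P[] /eqP/eq_set2[] [e1 e2]; first
  [ by left | by right | by rewrite e1 eqxx in nij
  | by rewrite e1 eqxx in njk | by rewrite e1 eqxx in njl ].
Qed.

(* A 4-cycle is an edge set, so its labelling is determined up to the dihedral group. *)
Lemma quad_invariant (T : Type) (P : V -> V -> V -> V -> T) :
  (forall i j k l, P i j k l = P j k l i) -> (forall i j k l, P i j k l = P i l k j) ->
  forall i j k l i' j' k' l', uniq [:: i; j; k; l] -> uniq [:: i'; j'; k'; l'] ->
    quad i j k l = quad i' j' k' l' -> P i j k l = P i' j' k' l'.
Proof.
move=> Prot Pref i j k l i' j' k' l' u u' E.
have uniq_rot a b c d : uniq [:: a; b; c; d] -> uniq [:: b; c; d; a].
  by rewrite -(rot_uniq 1).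
have uniq_ref a b c d : uniq [:: a; b; c; d] -> uniq [:: b; a; d; c].
  by rewrite -rev_uniq -(rot_uniq 2).
(* Once the first two labels agree, the remaining neighbours of [b] and of [a] are determined. *)
have fixed_edge a b c d : uniq [:: a; b; c; d] -> uniq [:: a; b; k'; l'] ->
    quad a b c d = quad a b k' l' -> P a b c d = P a b k' l'.
  move=> ua ub F.
  have : [set b; k'] \in quad a b c d by rewrite F !inE eqxx ?orbT.
  have : [set a; l'] \in quad d a b c by rewrite quad_rot F !inE [[set a; l']]setUC eqxx ?orbT.
  case/quad_neighbour => [|->|lb]; first by do 3!apply: (uniq_rot).
    case/quad_neighbour => // [ka|-> //].
    by move: ub; rewrite ka /= !inE eqxx !orbT.
  by move: ub; rewrite lb /= !inE eqxx !orbT andbF.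
(* This edge is one of the four of the cycle; a rotation, followed by a reflection if it is
   reversed, moves it to the front. *)
have : [set i'; j'] \in quad i j k l by rewrite E !inE eqxx.
have red a b c d : P i j k l = P a b c d -> quad i j k l = quad a b c d ->
    uniq [:: a; b; c; d] -> [set i'; j'] = [set a; b] -> P i j k l = P i' j' k' l'.
  move=> PE QE U /eq_set2[][ia jb]; subst i' j'.
    by rewrite PE; apply: fixed_edge; rewrite -?QE.
  rewrite PE Pref Prot Prot Prot; apply: fixed_edge => //; first exact: uniq_ref.
  by rewrite -E QE quad_ref 3!quad_rot.
rewrite !inE -!orbA => /or4P[] /eqP.
- exact: red.
- by apply: (red j k l i (Prot _ _ _ _) (quad_rot _ _ _ _)); apply: (uniq_rot).
- apply: (red k l i j (etrans (Prot _ _ _ _) (Prot _ _ _ _))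
    (etrans (quad_rot _ _ _ _) (quad_rot _ _ _ _))).
  by do 2!apply: (uniq_rot).
- apply: (red l i j k (esym (Prot _ _ _ _)) (esym (quad_rot _ _ _ _))).
  by do 3!apply: (uniq_rot).
Qed.

End Quads.

Local Open Scope ring_scope.

(** Labellings with the same edge set take their values in its cover, which has at most [#|U|]
    points; this bounds each fibre of [e]. *)
Lemma card_labellings (V U : finType) (D : {set {ffun U -> V}})
    (e : {ffun U -> V} -> {set {set V}}) :
  {in D, forall x : {ffun U -> V}, cover (e x) = [set x u | u : U]} ->
  (#|D| <= #|U| ^ #|U| * #|e @: D|)%N.
Proof.
move=> eD; rewrite -sum1_card (partition_big_imset e) /= mulnC -sum_nat_const.
apply: leq_sum => _ /imsetP[x0 x0D ->]; rewrite sum1_card.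
have cov : (#|cover (e x0)| <= #|U|)%N by rewrite eD // leq_imset_card.
have le_pow : (#|cover (e x0)| ^ #|U| <= #|U| ^ #|U|)%N.
  by have [->|U_gt0] := posnP #|U|; rewrite ?expn0 ?leq_exp2r.
apply: leq_trans le_pow; rewrite -(card_ffun_on U (mem (cover (e x0)))).
apply/subset_leq_card/subsetP=> x; rewrite unfold_in => /andP[xD /eqP xx0].
by apply/ffun_onP=> u; rewrite -xx0 eD // imset_f.
Qed.

(** * The standard cube in coordinates *)

Section Cubes.
Variable V : finType.

Notation bits := (bool * bool * bool)%type.

Definition bit (d : nat) (t : bits) : bool :=
  match d with 0%N => t.1.1 | 1%N => t.1.2 | _ => t.2 end.

(** Triples of booleans allow adjacency and faces of the cube to be checked by computation. *)
Definition corner (t : bits) : Q3 := [ffun d : 'I_3 => bit d t].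

Lemma corner_inj : injective corner.
Proof.
move=> [[a b] c] [[a' b'] c'] /ffunP E.
have := E (Ordinal (isT : 0 < 3)%N); have := E (Ordinal (isT : 1 < 3)%N).
by have := E (Ordinal (isT : 2 < 3)%N); rewrite !ffunE /= => -> -> ->.
Qed.

Lemma corner_onto (u : Q3) : exists t, u = corner t.
Proof.
exists (u (Ordinal (isT : 0 < 3)%N), u (Ordinal (isT : 1 < 3)%N), u (Ordinal (isT : 2 < 3)%N)).
apply/ffunP=> -[[|[|[|]]] //= Hd]; rewrite ffunE /=; congr (u _); exact: val_inj.
Qed.

Definition bits_adj (s t : bits) : bool :=
  ((bit 0 s != bit 0 t) + (bit 1 s != bit 1 t) + (bit 2 s != bit 2 t) == 1)%N.

Lemma corner_adj s t : Q3_adj (corner s) (corner t) = bits_adj s t.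
Proof.
rewrite /Q3_adj cardsE -sum1_card big_mkcond !big_ord_recl big_ord0 /=.
rewrite !unfold_in /= !ffunE /bits_adj /=.
by move: s t => [[[] []] []] [[[] []] []].
Qed.

Definition all_bits : seq bits :=
  let B := [:: false; true] in allpairs pair (allpairs pair B B) B.

Lemma mem_all_bits t : t \in all_bits.
Proof. by move: t => [[[] []] []]. Qed.

Lemma bits_adjC s t : bits_adj s t = bits_adj t s.
Proof. by move: s t => [[[] []] []] [[[] []] []]. Qed.

Lemma corner_edges (x : {ffun Q3 -> V}) s t : injective x ->
  ([set x (corner s); x (corner t)] \in cube_edges x) = bits_adj s t.
Proof.
move=> x_inj; apply/imset2P/idP => [[u v _]|st]; last first.
  by exists (corner s) (corner t); rewrite // inE corner_adj.
have [u' ->] := corner_onto u; have [v' ->] := corner_onto v.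
rewrite inE corner_adj => /andP[_ uv] /eq_set2[] [/x_inj/corner_inj-> /x_inj/corner_inj-> //].
by rewrite bits_adjC.
Qed.

Lemma cover_cube_edges (x : {ffun Q3 -> V}) : cover (cube_edges x) = [set x u | u : Q3].
Proof.
apply/setP=> w; apply/bigcupP/imsetP => [[_ /imset2P[u v _ _ ->]]|[u _ ->]].
  by rewrite !inE => /orP[]/eqP->; [exists u|exists v].
have [[[a b] c] ->] := corner_onto u.
exists [set x (corner (a, b, c)); x (corner (~~ a, b, c))]; last by rewrite set21.
apply/imset2P; exists (corner (a, b, c)) (corner (~~ a, b, c)); rewrite ?inE //.
by rewrite corner_adj /bits_adj /= !eqxx; case: a.
Qed.

End Cubes.

(** * The six faces of a labelled cube *)

Section Faces.
Variable V : finType.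

Notation bits := (bool * bool * bool)%type.

(** The order and orientation are those of the terms of [cube_sum]. *)
Definition cube_faces : seq (bits * bits * bits * bits) :=
  let i := (false, false, false) in let j := (true, false, false) in
  let k := (true, true, false) in let l := (false, true, false) in
  let a := (false, false, true) in let b := (true, false, true) in
  let c := (true, true, true) in let d := (false, true, true) in
  [:: (i, j, k, l); (a, b, c, d); (i, j, b, a); (j, k, c, b); (k, l, d, c); (l, i, a, d)].

Definition cycle_labellings (f : bits * bits * bits * bits) :=
  let: (a, b, c, d) := f in
  [:: (a, b, c, d); (b, c, d, a); (c, d, a, b); (d, a, b, c);
      (a, d, c, b); (d, c, b, a); (c, b, a, d); (b, a, d, c)].

(** Checked by enumeration, where each adjacency is tested as early as possible to prune the
    search. *)
Lemma bits_cycle s t u v : uniq [:: s; t; u; v] ->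
  bits_adj s t -> bits_adj t u -> bits_adj u v -> bits_adj v s ->
  exists2 f, f \in cube_faces & (s, t, u, v) \in cycle_labellings f.
Proof.
move=> U st tu uv vs; apply/hasP; move: U; apply/implyP.
have := isT : all (fun s => all (fun t => bits_adj s t ==>
  all (fun u => bits_adj t u ==> all (fun v => bits_adj u v ==> (bits_adj v s ==>
    (uniq [:: s; t; u; v] ==> has (fun f => (s, t, u, v) \in cycle_labellings f) cube_faces)))
  all_bits) all_bits) all_bits) all_bits.
move/allP/(_ s (mem_all_bits s))/allP/(_ t (mem_all_bits t)); rewrite st.
move/allP/(_ u (mem_all_bits u)); rewrite tu.
by move/allP/(_ v (mem_all_bits v)); rewrite uv vs.
Qed.

Variable x : {ffun Q3 -> V}.
Hypothesis x_inj : injective x.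

Definition face_quad (f : bits * bits * bits * bits) :=
  let: (a, b, c, d) := f in
  quad (x (corner a)) (x (corner b)) (x (corner c)) (x (corner d)).

Lemma face_quad_labelling f f' : f \in cycle_labellings f' -> face_quad f = face_quad f'.
Proof.
case: f' => [[[a b] c] d]; rewrite /cycle_labellings !inE -?orbA.
case/or4P=> [/eqP->|/eqP->|/eqP->|/orP[/eqP->|/or4P[] /eqP->]] //=.
- by rewrite [RHS]quad_rot.
- by rewrite 2!quad_rot.
- by rewrite quad_rot.
- by rewrite quad_ref.
- by rewrite 3!quad_rot quad_ref.
- by rewrite 2!quad_rot quad_ref.
- by rewrite quad_rot quad_ref.
Qed.

(** For a concrete face the hypothesis is a closed boolean test: the ordered adjacent pairs inside
    the face are the four edges of the cycle in both directions. *)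
Lemma face_edgesE (d : 'I_3) e t0 t1 t2 t3 :
  all (fun s => all (fun t => [&& bit d s == e, bit d t == e & bits_adj s t] ==
    ((s, t) \in [:: (t0, t1); (t1, t2); (t2, t3); (t3, t0);
                    (t1, t0); (t2, t1); (t3, t2); (t0, t3)])) all_bits) all_bits ->
  face_edges x d e = face_quad (t0, t1, t2, t3).
Proof.
move=> /allP chk.
have {}chk s t : [&& corner s d == e, corner t d == e & Q3_adj (corner s) (corner t)] =
    ((s, t) \in [:: (t0, t1); (t1, t2); (t2, t3); (t3, t0);
                    (t1, t0); (t2, t1); (t3, t2); (t0, t3)]).
  have /allP/(_ t (mem_all_bits t))/eqP <- := chk s (mem_all_bits s).
  by rewrite !ffunE corner_adj.
apply/setP=> E; apply/imset2P/idP => [[u v _]|].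
  have [s ->] := corner_onto u; have [t ->] := corner_onto v.
  rewrite inE /= chk !inE -?orbA => + ->.
  do 4?[case/orP=> [/eqP[-> ->]|]; first by rewrite eqxx ?orbT].
  by case/or4P=> /eqP[-> ->]; rewrite setUC eqxx ?orbT.
have edge s t : (s, t) \in [:: (t0, t1); (t1, t2); (t2, t3); (t3, t0);
      (t1, t0); (t2, t1); (t3, t2); (t0, t3)] -> E == [set x (corner s); x (corner t)] ->
    exists2 u, u \in Q3 & exists2 v, v \in Q3 &
      [&& u d == e, v d == e & Q3_adj u v] /\ E = [set x u; x v].
  by move=> st /eqP->; exists (corner s) => //; exists (corner t); rewrite // chk.
rewrite !inE -?orbA => EE.
have [u _ [v _ [uv ->]]] : exists2 u, u \in Q3 & exists2 v, v \in Q3 &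
    [&& u d == e, v d == e & Q3_adj u v] /\ E = [set x u; x v].
  by case/or4P: EE => /edge; apply; rewrite !inE eqxx ?orbT.
by exists u v; rewrite // inE.
Qed.

Lemma uniq_face_quad s t u v : uniq [:: s; t; u; v] ->
  uniq [:: x (corner s); x (corner t); x (corner u); x (corner v)].
Proof. by rewrite -(map_inj_uniq (inj_comp x_inj corner_inj)). Qed.

(** A face for another labelling of [C] is still a 4-cycle of edges of [C], so by [bits_cycle] it is
    one of the six faces for [x]. *)
Lemma is_face_quad (C : cube V) (s : square V) : sval C = cube_edges x ->
  is_face C s = (sval s \in map face_quad cube_faces).
Proof.
move=> Cx; apply/idP/mapP => [|[f]].
  case/existsP=> y /existsP[d /existsP[e /and3P[_ /eqP Cy /eqP sy]]].
  have sub E : E \in sval s -> E \in cube_edges x.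
    rewrite sy -Cx Cy => /imset2P[u v _]; rewrite inE => /andP[_ /and3P[_ _ uv]] ->.
    by apply/imset2P; exists u v; rewrite // inE.
  have /existsP[i /existsP[j /existsP[k /existsP[l /andP[ijkl /eqP sE]]]]] := valP s.
  have {}sE : sval s = quad i j k l := sE.
  have cor w : w \in [:: i; j; k; l] -> exists t, w = x (corner t).
    rewrite -cover_quad -sE => /bigcupP[E /sub Ex wE].
    have : w \in cover (cube_edges x) by apply/bigcupP; exists E.
    rewrite cover_cube_edges => /imsetP[u _ ->].
    by have [t ->] := corner_onto u; exists t.
  have [t0 i0] : exists t, i = x (corner t) by apply: cor; rewrite !inE eqxx.
  have [t1 j1] : exists t, j = x (corner t) by apply: cor; rewrite !inE eqxx ?orbT.
  have [t2 k2] : exists t, k = x (corner t) by apply: cor; rewrite !inE eqxx ?orbT.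
  have [t3 l3] : exists t, l = x (corner t) by apply: cor; rewrite !inE eqxx ?orbT.
  subst i j k l; move: ijkl.
  rewrite (map_inj_uniq (inj_comp x_inj corner_inj) [:: t0; t1; t2; t3]) => U.
  have adj a b : [set x (corner a); x (corner b)] \in sval s -> bits_adj a b.
    by move/sub; rewrite corner_edges.
  have [||||f fF tf] := bits_cycle U; rewrite ?adj // ?sE ?inE ?eqxx ?orbT //.
  by exists f => //; rewrite -(face_quad_labelling tf).
move=> fF sf; apply/existsP; exists x.
suff [d [e E]] : exists d e, face_edges x d e = face_quad f.
  apply/existsP; exists d; apply/existsP; exists e.
  by rewrite Cx E sf !eqxx !andbT; apply/injectiveP.
have F := face_edgesE; move: fF; rewrite !inE -?orbA.
case/or4P=> [/eqP->|/eqP->|/eqP->|/or3P[] /eqP->].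
- by exists (Ordinal (isT : 2 < 3)%N), false; apply: F.
- by exists (Ordinal (isT : 2 < 3)%N), true; apply: F.
- by exists (Ordinal (isT : 1 < 3)%N), false; apply: F.
- by exists (Ordinal (isT : 0 < 3)%N), true; apply: F.
- by exists (Ordinal (isT : 1 < 3)%N), true; apply: F.
- by exists (Ordinal (isT : 0 < 3)%N), false; apply: F.
Qed.

(** The faces differ in their vertex sets, which [sig] turns into lists of booleans that do not
    depend on [x]. *)
Lemma face_quads_uniq : uniq (map face_quad cube_faces).
Proof.
pose sig (E : {set {set V}}) := [seq x (corner t) \in cover E | t <- all_bits].
have sigE f : sig (face_quad f) =
    let: (a, b, c, d) := f in [seq t \in [:: a; b; c; d] | t <- all_bits].
  case: f => [[[a b] c] d]; apply: eq_map => t; rewrite cover_quad.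
  by rewrite -(mem_map (inj_comp x_inj corner_inj) [:: a; b; c; d]).
by apply: (@map_uniq _ _ sig); rewrite -map_comp (eq_map sigE).
Qed.

Lemma face_quads_square : all (@is_square V) (map face_quad cube_faces).
Proof.
apply/allP=> _ /mapP[f fF ->].
move: fF; rewrite !inE -?orbA => /or4P[/eqP->|/eqP->|/eqP->|/or3P[] /eqP->];
  exact/quad_is_square/uniq_face_quad.
Qed.

End Faces.

(** * The signs of [g] as booleans *)

Section SquareSigns.
Variables (V : finType) (g : square V -> int).
Hypothesis g_sign : forall s, g s \in mu2.

(** The default [false] extends the sign to all edge sets, so that the dihedral symmetry of
    [square_sign] holds for degenerate tuples too. *)
Definition quad_sign (E : {set {set V}}) : bool :=
  if insub E is Some s then g s == -1 else false.

Definition square_sign i j k l := quad_sign (quad i j k l).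

Lemma quad_signE (s : square V) : g s = (-1) ^+ quad_sign (sval s).
Proof.
have -> : quad_sign (sval s) = (g s == -1) by rewrite /quad_sign valK.
by have := g_sign s; rewrite inE => /orP[] /eqP->.
Qed.

Lemma prod_squares (L : seq {set {set V}}) : uniq L -> all (@is_square V) L ->
  \prod_(s : square V | sval s \in L) g s = \prod_(E <- L) (-1) ^+ quad_sign E.
Proof.
move=> uL sqL; pose L' : seq (square V) := pmap insub L.
have -> : L = map val L'.
  by rewrite (pmap_filter (insubK _)) (eq_filter (isSome_insub _)) (all_filterP sqL).
rewrite big_map [RHS]big_uniq ?pmap_sub_uniq //=.
by apply: eq_big => s; [rewrite (mem_map val_inj)|rewrite quad_signE].
Qed.

Lemma cube_prodE (C : cube V) (x : {ffun Q3 -> V}) :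
  injective x -> sval C = cube_edges x ->
  let X a b c := x (corner (a, b, c)) in
  cube_prod g C = (-1) ^+ cube_sum square_sign
    (X false false false) (X true false false) (X true true false) (X false true false)
    (X false false true) (X true false true) (X true true true) (X false true true).
Proof.
move=> x_inj Cx X; rewrite /cube_prod (eq_bigl _ _ (fun s => is_face_quad x_inj s Cx)).
rewrite prod_squares ?face_quads_uniq ?face_quads_square //.
have sign6 (b1 b2 b3 b4 b5 b6 : bool) : (-1) ^+ b1 * ((-1) ^+ b2 * ((-1) ^+ b3 *
    ((-1) ^+ b4 * ((-1) ^+ b5 * ((-1) ^+ b6 * 1)))))
    = (-1) ^+ (b1 (+) b2 (+) b3 (+) b4 (+) b5 (+) b6) :> int.
  by rewrite !signr_addb !mulrA mulr1.
by rewrite big_map !big_cons big_nil sign6.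
Qed.

End SquareSigns.

Local Notation word4 V := {ffun 'I_4 -> V}.
Local Notation "w '`[' m ']'" := (w (Ordinal (isT : (m < 4)%N))) (at level 2).

(** * Failing cubes near a base tuple *)

Section BadCubes.
Variables (V : finType) (G : V -> V -> V -> V -> bool).

Definition bad_labelling (x : {ffun Q3 -> V}) :=
  let X a b c := x (corner (a, b, c)) in
  injectiveb x && cube_sum G
    (X false false false) (X true false false) (X true true false) (X false true false)
    (X false false true) (X true false true) (X true true true) (X false true true).

Lemma labelling_of_points (i j k l a b c d : V) : uniq [:: i; j; k; l; a; b; c; d] ->
  cube_sum G i j k l a b c d ->
  exists2 x, bad_labelling x & forall u, x u \in [:: i; j; k; l; a; b; c; d].
Proof.
set pts := [:: i; j; k; l; a; b; c; d] => upts bad.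
(* The corners in the order in which [bad_labelling] passes them to [cube_sum]. *)
pose L := [:: (false, false, false); (true, false, false); (true, true, false);
  (false, true, false); (false, false, true); (true, false, true);
  (true, true, true); (false, true, true)].
pose x : {ffun Q3 -> V} := [ffun u => nth i pts (index u (map corner L))].
have memL u : u \in map corner L.
  have [t ->] := corner_onto u; rewrite (mem_map corner_inj).
  by move: t => [[[] []] []].
have ltL u : (index u (map corner L) < 8)%N by rewrite index_mem memL.
exists x => [|u]; last by rewrite ffunE mem_nth.
have xE t : x (corner t) = nth i pts (index t L) by rewrite ffunE (index_map corner_inj).
rewrite /bad_labelling !xE andbC bad; apply/injectiveP=> u v; rewrite !ffunE => /eqP.
rewrite (nth_uniq i _ _ upts) // => /eqP uv.
by rewrite -[u](nth_index u (memL u)) uv nth_index.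
Qed.

Definition base_nbhd (z : {ffun 'I_10 -> V}) (w : word4 V) : {set V} :=
  [set z a | a : 'I_10] :|: [set w`[0]; w`[1]; w`[2]; w`[3]].

(** A pair [(z, w)] is one function on ['I_10 + 'I_4]. If its neighbourhood is not closed, its
    values include the 8 vertices of a bad labelling, which leaves 14 - 8 = 6 free positions;
    [pigeonhole_fibre] then fixes [z]. *)
Lemma few_bad_extensions : (10 <= #|V|)%N ->
  exists2 z : {ffun 'I_10 -> V}, injective z &
    (#|V| ^_ 10 * #|[set w : word4 V | ~~ `[< closed_on G (base_nbhd z w) >] ]|
      <= #|{: 'I_10 + 'I_4}| ^ #|Q3| * (#|[set x | bad_labelling x]| * #|V| ^ 6))%N.
Proof.
move=> cardV; pose Z := [set z : {ffun 'I_10 -> V} | injectiveb z].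
have cardZ : #|Z| = (#|V| ^_ 10)%N by rewrite card_inj_ffuns card_ord.
have Z0 : Z != set0 by rewrite -card_gt0 cardZ ffact_gt0.
have [z zZ] := pigeonhole_fibre
  (fun z => [set w : word4 V | ~~ `[< closed_on G (base_nbhd z w) >] ]) Z0.
rewrite cardZ => le_z; exists z; first by apply/injectiveP; rewrite inE in zZ.
apply: leq_trans le_z _.
have E6 : (#|{: 'I_10 + 'I_4}| - #|Q3|)%N = 6%N.
  by rewrite card_sum !card_ord card_ffun card_bool card_ord.
have Binj : {in [set x | bad_labelling x], forall x : {ffun Q3 -> V}, injective x}.
  by move=> x; rewrite inE => /andP[/injectiveP].
have := card_covering ('I_10 + 'I_4)%type Binj; rewrite E6; apply: leq_trans.
apply/subset_leq_card/subsetP=> y.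
rewrite !inE => /andP[_]; apply: contraNT => noBad; apply/asboolP.
move=> i j k l a b c d /andP[U /allP sub]; apply: contraNF noBad => bad.
have [x xbad xpts] := labelling_of_points U bad.
apply/existsP; exists x; rewrite inE xbad; apply/forallP=> u.
have /sub := xpts u; rewrite !inE -!orbA => /orP[/imsetP[m _ ->]|].
  by rewrite ffunE codom_f.
by case/or4P=> /eqP->; rewrite ffunE codom_f.
Qed.

End BadCubes.

(** The edge set of a bad labelling is a failing cube by [cube_prodE], and each cube has at most
    [8 ^ 8] labellings. *)
Lemma card_bad_labellings (V : finType) (g : square V -> int) :
  (forall s, g s \in mu2) ->
  (#|[set x | bad_labelling (square_sign g) x]| <=
    #|Q3| ^ #|Q3| * #|[pred C : cube V | cube_prod g C == -1%R]|)%N.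
Proof.
move=> g_sign; set B := [set x | _].
apply: leq_trans (card_labellings (e := @cube_edges V) _) _ => [x _|].
  exact: cover_cube_edges.
rewrite leq_mul2l; apply/orP; right.
rewrite -(card_imset [pred C : cube V | cube_prod g C == -1%R] val_inj).
apply/subset_leq_card/subsetP=> _ /imsetP[x xB ->].
move: xB; rewrite inE => /andP[xi bad]; have x_inj := injectiveP _ xi.
have xC : is_cube (cube_edges x) by apply/existsP; exists x; rewrite xi eqxx.
apply/imsetP; exists (exist (@is_cube V) _ xC) => //.
by rewrite inE (cube_prodE g_sign x_inj) // bad.
Qed.

(** This converts the probability bound on failing cubes into a bound on their number. *)
Lemma card_cube_leq (V : finType) : (#|cube V| <= #|V| ^ 8)%N.
Proof.
have <- : #|{ffun Q3 -> V}| = (#|V| ^ 8)%N by rewrite !card_ffun card_bool card_ord.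
rewrite card_sig; apply: leq_trans (leq_imset_card (@cube_edges V) predT).
apply/subset_leq_card/subsetP=> E /existsP[x /andP[_ /eqP->]].
exact: imset_f.
Qed.

(** * Squares as words of length four *)

Section Squares.
Variable V : finType.

Definition word_quad (w : word4 V) := quad w`[0] w`[1] w`[2] w`[3].

Lemma word_quad_onto i j k l : uniq [:: i; j; k; l] ->
  exists2 w : word4 V, injective w &
    [/\ w`[0] = i, w`[1] = j, w`[2] = k & w`[3] = l].
Proof.
move=> U; exists [ffun m : 'I_4 => nth i [:: i; j; k; l] m]; last by rewrite !ffunE.
by move=> m n; rewrite !ffunE => /eqP; rewrite nth_uniq // => /eqP/val_inj.
Qed.

(** A lower bound, since the number of squares is the denominator of the final probability. *)
Lemma card_square_geq : (#|V| ^_ 4 <= #|'I_4| ^ #|'I_4| * #|square V|)%N.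
Proof.
have <- : #|[set w : word4 V | injectiveb w]| = (#|V| ^_ 4)%N.
  by rewrite card_inj_ffuns card_ord.
apply: leq_trans (card_labellings (e := word_quad) _) _ => [w _|].
  apply/setP=> v; rewrite cover_quad !inE; apply/idP/imsetP => [|[m _ ->]].
    by case/or4P=> /eqP->; eexists.
  case: m => [[|[|[|[|]]]] // Hm]; rewrite (bool_irrelevance Hm isT) eqxx ?orbT //.
rewrite leq_mul2l; apply/orP; right; rewrite card_sig.
apply/subset_leq_card/subsetP=> _ /imsetP[w wi ->]; rewrite unfold_in.
apply: quad_is_square; move: wi; rewrite inE => /injectiveP wi.
by rewrite (map_inj_uniq wi [:: _; _; _; _]).
Qed.

End Squares.

(** A rotation transposes all four [f]-terms and so adds [s] four times, which cancels; the
    reflection permutes the terms. Any labelling of an edge set therefore gives the same value. *)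
Lemma quad_sign_inv (V : finType) (s : bool) (e : bool) (f : V -> V -> bool) :
  (forall i j, i != j -> f i j (+) f j i = s) ->
  exists P : {set {set V}} -> bool, forall i j k l, uniq [:: i; j; k; l] ->
    P (quad i j k l) = e (+) f i j (+) f k j (+) f k l (+) f i l.
Proof.
(* The factor [uniq] makes [Q] invariant at all tuples, as [quad_invariant] demands, although [fs]
   covers distinct points only. *)
move=> fs; pose Q i j k l :=
  uniq [:: i; j; k; l] && (e (+) f i j (+) f k j (+) f k l (+) f i l).
have Qrot i j k l : Q i j k l = Q j k l i.
  have UE : uniq [:: j; k; l; i] = uniq [:: i; j; k; l] by rewrite -(rot_uniq 1 [:: i; j; k; l]).
  rewrite /Q UE; case: (boolP (uniq _)) => [U|//]; rewrite !andTb.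
  have fC x y : x != y -> f x y = s (+) f y x.
    by move/fs <-; rewrite -addbA addbb addbF.
  rewrite (fC i j) ?(fC k l) ?(fC i l) ?(fC k j); try distinct.

  by case: (e); case: (s); case: (f j i); case: (f j k); case: (f l k); case: (f l i).
have Qref i j k l : Q i j k l = Q i l k j.
  rewrite /Q; congr (_ && _); last first.
    by case: (e); case: (f i j); case: (f k j); case: (f k l); case: (f i l).
  by rewrite -(rot_uniq 1 [:: i; l; k; j]) -rev_uniq.
pose rep (E : {set {set V}}) (q : V * V * V * V) :=
  let: (i, j, k, l) := q in uniq [:: i; j; k; l] && (E == quad i j k l).
exists (fun E => if [pick q | rep E q] is Some (i, j, k, l) then Q i j k l else false).
move=> i j k l U; have -> : e (+) f i j (+) f k j (+) f k l (+) f i l = Q i j k l.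
  by rewrite /Q U.
case: pickP => [[[[i' j'] k'] l'] /andP[U' /eqP E]|/(_ (i, j, k, l))].
  by apply: (quad_invariant Qrot Qref).
by rewrite /rep U eqxx.
Qed.

(** * Arithmetic of the final count *)

Lemma expn_leq_ffact n m : (10 <= n -> m <= 10 -> n ^ m <= 10 ^ m * n ^_ m)%N.
Proof.
move=> n10; elim: m => [|m IH] m10 //.
rewrite expnSr expnSr ffactnSr mulnACA; apply: leq_mul (IH (ltnW m10)) _.
have mn : (m < n)%N := leq_trans m10 n10.
(* The new factor satisfies [n <= 10 * (n - m)], because [m <= 9] and [1 <= n - m]. *)
rewrite -{1}(subnK (ltnW mn)) (mulSn 9) leq_add2l.
by apply: (@leq_trans (9 * 1)); rewrite // leq_mul2l subn_gt0 mn.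
Qed.

(** Here [x4] to [x10] stand for powers of [#|V|], [F4] and [F10] for falling factorials, [w] for
    wrong squares, [W] for words with a neighbourhood that is not closed, [B] for bad labellings,
    [b] for failing cubes, [S] for squares. Multiplication by [x6] lets [x8 * x6] split as
    [x10 * x4], one factor for the base tuple and one for the square. *)
Lemma combine_counts (x4 x6 x8 x10 F4 F10 T4 T10 K0 K1 K2 w W B b S : nat) :
  (0 < x6 -> x8 * x6 = x10 * x4 -> x10 <= T10 * F10 -> x4 <= T4 * F4 ->
   F10 * W <= K0 * (B * x6) -> w <= W -> B <= K1 * b -> F4 <= K2 * S ->
   w * x8 <= K0 * K1 * K2 * T10 * T4 * S * b)%N.
Proof.
move=> x6_gt0 xE x10F x4F FW wW Bb F4S; rewrite -(leq_pmul2r x6_gt0).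
apply: (@leq_trans (W * ((T10 * F10) * (T4 * (K2 * S))))).
  rewrite -mulnA xE; apply: leq_mul => //; apply: leq_mul => //.
  by apply: leq_trans x4F _; rewrite leq_mul2l F4S orbT.
have -> : (W * ((T10 * F10) * (T4 * (K2 * S))) = F10 * W * (T10 * T4 * K2 * S))%N by ring.
apply: (@leq_trans (K0 * (K1 * b * x6) * (T10 * T4 * K2 * S))).
  apply: leq_mul => //; apply: leq_trans FW _.
  by rewrite leq_mul2l leq_mul2r Bb !orbT.
by apply: eq_leq; ring.
Qed.

Lemma sign_mu2 (b : bool) : (-1) ^+ b \in mu2.
Proof. by case: b; rewrite inE. Qed.

(* 14^8 placements of a cube among the positions of (z, i, j, k, l), 8^8 and 4^4
   bounds for the labellings of a cube and a square, and 10^m for n^m / n^_m. *)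
Definition loss : nat :=
  (#|{: 'I_10 + 'I_4}| ^ #|Q3| * #|Q3| ^ #|Q3| * #|'I_4| ^ #|'I_4| * 10 ^ 10 * 10 ^ 4)%N.

Lemma loss_gt0 : (0 < loss)%N.
Proof.
by rewrite /loss !muln_gt0 !expn_gt0 card_sum !card_ord card_ffun card_bool !card_ord.
Qed.

Lemma few_wrong_squares (V : finType) (g : square V -> int) :
  (10 <= #|V|)%N -> (forall s, g s \in mu2) ->
  exists (e : bool) (f : V -> V -> bool) (P : {set {set V}} -> bool),
    (forall i j k l, uniq [:: i; j; k; l] ->
      P (quad i j k l) = e (+) f i j (+) f k j (+) f k l (+) f i l) /\
    (#|[pred s : square V | (g s != (-1) ^+ P (sval s))%R]| * #|V| ^ 8 <=
      loss * #|square V| * #|[pred C : cube V | (cube_prod g C == -1)%R]|)%N.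
Proof.
move=> cardV g_sign; pose G := square_sign g.
have Grot i j k l : G i j k l = G j k l i by rewrite /G /square_sign quad_rot.
have Gref i j k l : G i j k l = G i l k j by rewrite /G /square_sign quad_ref.
have [z z_inj zW] := few_bad_extensions G cardV.
have cardz : (10 <= #|[set z a | a : 'I_10]|)%N by rewrite card_imset // card_ord.
have [e [s [f [fs fG]]]] := local_decoding Grot Gref cardz.
have [P PE] := quad_sign_inv e fs.
exists e, f, P; split=> //.
set wrong := #|[pred s | _]|; set W := [set w | ~~ _] in zW.
(* Every wrong square is the image of a word in [W], since [fG] makes the formula correct on closed
   neighbourhoods. *)
have wrongW : (wrong <= #|W|)%N.
  rewrite /wrong -(card_imset [pred s | g s != (-1) ^+ P (sval s)] val_inj).
  apply: leq_trans (leq_imset_card (@word_quad V) W).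
  apply/subset_leq_card/subsetP=> _ /imsetP[t /= tw ->].
  have /existsP[i /existsP[j /existsP[k /existsP[l /andP[U /eqP tE]]]]] := valP t.
  have [w _ [wi wj wk wl]] := word_quad_onto U.
  apply/imsetP; exists w; last by rewrite /word_quad wi wj wk wl.
  move: tw; rewrite !inE; apply: contra => /asboolP; rewrite /base_nbhd wi wj wk wl.
  move=> /(fG _ _ _ _ U); rewrite -PE // -tE => GE.
  by rewrite (quad_signE g_sign) /= -GE /G /square_sign -tE.
have bad := card_bad_labellings g_sign.
have sq := card_square_geq V.
apply: (combine_counts (x4 := (#|V| ^ 4)%N) (x10 := (#|V| ^ 10)%N) _ _ _ _ zW wrongW bad sq).
- by rewrite expn_gt0 (leq_trans _ cardV).
- by rewrite -!expnD.
- exact: expn_leq_ffact.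
- exact: expn_leq_ffact.
Qed.

Theorem theorem2p1 (R : realType) :
  exists omega : R, 0 < omega /\
    forall (V : finType) (p : R) (g : square V -> int),
      (10 <= #|V|)%N -> 0 <= p -> (forall s, g s \in mu2) ->
      uniform_pr R [pred C : cube V | cube_prod g C == -1] <= p ->
      exists (epsilon : int) (f : V -> V -> int) (g' : square V -> int),
        [/\ epsilon \in mu2,
            forall i j, i != j -> f i j \in mu2,
            forall s, g' s \in mu2,
            forall (i j k l : V) (u : uniq [:: i; j; k; l]),
              g' (Square u) = epsilon * f i j * f k j * f k l * f i l
          & uniform_pr R [pred s : square V | g s != g' s] <= omega^-1 * p].
Proof.
exists (loss%:R^-1); split; first by rewrite invr_gt0 ltr0n loss_gt0.
move=> V p g cardV p_ge0 g_sign; rewrite /uniform_pr invrK => bad_le.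
have [e [f [P [PE wrong_le]]]] := few_wrong_squares cardV g_sign.
exists ((-1) ^+ e), (fun i j => (-1) ^+ f i j), (fun s => (-1) ^+ P (sval s)).
split=> [|i j _|s|i j k l u|]; try exact: sign_mu2.
  by rewrite /= PE // !signr_addb.
set wrong := #|_| in wrong_le *; set bad := #|_| in wrong_le bad_le.
have n_gt0 : (0 < #|V|)%N by apply: leq_trans cardV.
have bad_card : bad%:R <= p * (#|V| ^ 8)%:R :> R.
  (* A quotient by zero is 0 and would bound nothing, but with no cubes [bad] itself is 0. *)
  have [C0|C_gt0] := posnP #|cube V|.
    have -> : bad = 0%N by apply/eqP; rewrite -leqn0 -C0 max_card.
    by rewrite mulr_ge0 ?ler0n.
  move: bad_le; rewrite ler_pdivrMr ?ltr0n // => /le_trans; apply.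
  by rewrite ler_wpM2l // ler_nat card_cube_leq.
have [S0|S_gt0] := posnP #|square V|.
  by rewrite S0 invr0 mulr0 mulr_ge0 ?ler0n.
(* Both sides are multiplied by [#|V| ^ 8], the factor shared by [wrong_le] and [bad_card]. *)
rewrite ler_pdivrMr ?ltr0n // -(ler_pM2r (x := (#|V| ^ 8)%:R)) ?ltr0n ?expn_gt0 ?n_gt0 //.
rewrite -natrM; apply: (@le_trans _ _ (loss * #|square V| * bad)%:R); first by rewrite ler_nat.
rewrite natrM; apply: le_trans (ler_wpM2l (ler0n _ _) bad_card) _; rewrite natrM.
move: loss%:R #|square V|%:R (#|V| ^ 8)%:R => x y z.
by have -> : x * y * (p * z) = x * p * y * z by ring.
Qed.
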